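(* Let $(X,\mu,\{T^{\vec n}\}_{\vec n\in\mathbb Z^2})$ be an infinite measure preserving, recurrent, and ergodic $\mathbb Z^2$ action on a $\sigma$-finite Lebesgue space. Then its set of recurrent directions $\mathcal R_T$ is a $G_\delta$ subset of $[0,\pi)$.
   Context: Infinite measure preserving means the maps $T^{\vec n}$ are invertible, measurable and $\mu$-preserving, with $\mu(X)=\infty$. The $\mathbb Z^2$ action is recurrent if for every measurable set $A$ with $\mu(A)>0$ there exists $\vec n\in\mathbb Z^2$, $\vec n\neq\vec 0$, such that $\mu(A\cap T^{\vec n}A)>0$. A direction is an angle $\theta\in[0,\pi)$. For $\epsilon>0$ the $\epsilon$-tunnel of $\theta$ is $\bigcup_{t\in\mathbb R}B_\epsilon(t(\cos\theta,\sin\theta))$, where $B_\epsilon(\vec x)$ is the $\epsilon$-ball around $\vec x\in\mathbb R^2$. A direction $\theta$ is recurrent for $T$ if for all $\epsilon>0$ and all measurable sets $A$ with $\mu(A)>0$ there is a non-zero vector $\vec n\in\mathbb Z^2$ in the $\epsilon$-tunnel of $\theta$ such that $\mu(A\cap T^{\vec n}A)>0$. $\mathcal R_T\subset[0,\pi)$ denotes the set of recurrent directions. *)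

(* Defs.v *)
From HB Require Import structures.
From mathcomp Require Import all_boot all_order all_algebra.
From mathcomp Require Import all_classical all_reals all_analysis.
From mathcomp Require Import measurable_realfun borel_hierarchy.

Set Implicit Arguments.
Unset Strict Implicit.
Unset Printing Implicit Defensive.

Import Order.TTheory GRing.Theory Num.Theory.
Import numFieldNormedType.Exports.

Local Open Scope classical_set_scope.
Local Open Scope ring_scope.

(* [completed_algebra_gen mu] is the sigma-algebra of the completion of [mu];
   on it, the completed measure is the outer measure [mu_ext mu]. *)

(* [f] restricts to an isomorphism of (completed) measure spaces from the part
   [A] of the first space onto the part [B] of the second one. *)
Definition measure_iso_on (R : realType) (d d' : measure_display)
    (X : measurableType d) (Y : measurableType d')
    (mu : set X -> \bar R) (nu : set Y -> \bar R)
    (A : set X) (B : set Y) (f : X -> Y) : Prop :=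
  set_bij A B f /\
  forall E : set X, E `<=` A ->
    (completed_algebra_gen mu E <-> completed_algebra_gen nu (f @` E)) /\
    (completed_algebra_gen mu E -> mu_ext mu E = mu_ext nu (f @` E)).

(* Rokhlin: mod 0, a Lebesgue space is the union of countably many points of
   positive measure (the set [D]) and of a copy of an interval with Lebesgue
   measure.  The interval may be empty or unbounded.  Everything is read in the
   completion of [mu], so that both complete spaces and standard Borel spaces
   are covered. *)
Definition lebesgue_space (R : realType) (d : measure_display)
    (X : measurableType d) (mu : set X -> \bar R) : Prop :=
  exists (D N : set X) (I : interval R) (M : set R) (f : X -> R),
    [/\ countable D,
        forall x, D x ->
          completed_algebra_gen mu [set x] /\ (0 < mu_ext mu [set x])%E,
        mu.-negligible N,
        (@lebesgue_measure R).-negligible M &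
        measure_iso_on mu (@lebesgue_measure R)
          (~` (D `|` N)) ([set` I] `\` M) f].

Record measure_preserving_action (R : realType) (d : measure_display)
    (X : measurableType d) (mu : set X -> \bar R)
    (T : int * int -> X -> X) : Prop := MeasurePreservingAction {
  action0 : T 0 = id ;
  actionD : forall m n, T (m + n) = T m \o T n ;
  action_measurable : forall n, measurable_fun setT (T n) ;
  action_preserving : forall n (A : set X), measurable A ->
    mu (T n @^-1` A) = mu A }.

Definition ergodic_action (R : realType) (d : measure_display)
    (X : measurableType d) (mu : set X -> \bar R)
    (T : int * int -> X -> X) : Prop :=
  forall A : set X, measurable A -> (forall n, T n @` A = A) ->
    mu A = 0%E \/ mu (~` A) = 0%E.

Definition recurrent_action (R : realType) (d : measure_display)
    (X : measurableType d) (mu : set X -> \bar R)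
    (T : int * int -> X -> X) : Prop :=
  forall A : set X, measurable A -> (0 < mu A)%E ->
    exists2 n : int * int, n != 0 & (0 < mu (A `&` T n @` A))%E.

(* The library norm on [R * R] is the sup norm, hence an explicit ball. *)
Definition euclidean_ball (R : realType) (x : R * R) (e : R) : set (R * R) :=
  [set y | Num.sqrt ((y.1 - x.1) ^+ 2 + (y.2 - x.2) ^+ 2) < e].

Definition tunnel (R : realType) (e theta : R) : set (R * R) :=
  \bigcup_(t in [set: R]) euclidean_ball (t * cos theta, t * sin theta) e.

Definition recurrent_direction (R : realType) (d : measure_display)
    (X : measurableType d) (mu : set X -> \bar R)
    (T : int * int -> X -> X) (theta : R) : Prop :=
  forall (e : R) (A : set X), 0 < e -> measurable A -> (0 < mu A)%E ->
    exists n : int * int,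
      [/\ n != 0, tunnel e theta (n.1%:~R, n.2%:~R) &
          (0 < mu (A `&` T n @` A))%E].

Definition recurrent_directions (R : realType) (d : measure_display)
    (X : measurableType d) (mu : set X -> \bar R)
    (T : int * int -> X -> X) : set R :=
  [set theta | 0 <= theta < pi /\ recurrent_direction mu T theta].

(* Main.v *)
(* A direction theta is recurrent iff every finite-measure C and every e > 0
   admit a finite set F of nonzero vectors in the e-tunnel such that every B in
   C with 6 mu(C \ B) < mu(C) satisfies mu(B /\ T^n B) > 0 for some n in F.
   The condition is open in theta. The "if" part only needs a family of sets C
   that contains, for each A of positive measure, a C with
   6 mu(C \ A) < mu(C): take B = C /\ A. A Lebesgue space has a countable such
   family: atoms and preimages of finite unions of rational intervals.
   For the "only if" part, enumerate the tunnel and match the points of C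
   greedily with points of C by T^n. If S and S' are the sets of matched sources
   and targets, C \ (S \/ S') never returns along the tunnel, so it is null;
   as mu(S) = mu(S'), at least half of C is a source, and finitely many steps
   already match more than a third of C. A set B of which C \ B is less than a
   sixth of C must then contain both ends of some matched pairs. *)
Require Import Defs.
From HB Require Import structures.
From mathcomp Require Import all_boot all_order all_algebra.
From mathcomp Require Import all_classical all_reals all_analysis.
From mathcomp Require Import measurable_realfun borel_hierarchy.
From mathcomp Require Import lra.

Import Order.TTheory GRing.Theory Num.Theory.
Import numFieldNormedType.Exports.

Set Implicit Arguments.
Unset Strict Implicit.
Unset Printing Implicit Defensive.

Local Open Scope classical_set_scope.
Local Open Scope ring_scope.

(** * Images and preimages under the action *)

Lemma action_image (R : realType) (d : measure_display) (X : measurableType d)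
    (mu : set X -> \bar R) (T : int * int -> X -> X) :
  measure_preserving_action mu T ->
  forall n A, T n @` A = T (- n) @^-1` A.
Proof.
move=> act n A; have TK m x : T (- m) (T m x) = x.
  by have /(congr1 (@^~ x))/= := actionD act (- m) m; rewrite addNr (action0 act).
apply/seteqP; split=> [_ [x Ax <-]|x Ax] /=; first by rewrite TK.
by exists (T (- n) x) => //; rewrite -{1}(opprK n) TK.
Qed.

Lemma measurable_action_preimage (R : realType) (d : measure_display)
    (X : measurableType d) (mu : set X -> \bar R) (T : int * int -> X -> X) :
  measure_preserving_action mu T ->
  forall n A, measurable A -> measurable (T n @^-1` A).
Proof.
by move=> act n A mA; rewrite -[_ @^-1` _]setTI; exact: (action_measurable act).
Qed.

Lemma measurable_action_image (R : realType) (d : measure_display)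
    (X : measurableType d) (mu : set X -> \bar R) (T : int * int -> X -> X) :
  measure_preserving_action mu T ->
  forall n A, measurable A -> measurable (T n @` A).
Proof.
move=> act n A mA; rewrite (action_image act).
exact: (measurable_action_preimage act).
Qed.

Lemma measure_action_image (R : realType) (d : measure_display)
    (X : measurableType d) (mu : set X -> \bar R) (T : int * int -> X -> X) :
  measure_preserving_action mu T ->
  forall n A, measurable A -> mu (T n @` A) = mu A.
Proof.
move=> act n A mA; rewrite (action_image act).
exact: (action_preserving act).
Qed.

(** * Greedy matching and returns along finitely many vectors *)

Definition returns_along (R : realType) (d : measure_display)
    (X : measurableType d) (mu : set X -> \bar R) (T : int * int -> X -> X)
    (C : set X) (F : seq (int * int)) : Prop :=
  forall B, measurable B -> B `<=` C -> (6%:E * mu (C `\` B) < mu C)%E ->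
  exists2 n, n \in F & (0 < mu (B `&` T n @` B))%E.

(* Step [i] matches every still unmatched [x] with [T (nu i) x], whenever the
   latter is an element of [C] that is not yet an image. *)
Fixpoint greedy_matching (X : Type) (T : int * int -> X -> X) (C : set X)
    (nu : nat -> int * int) (k : nat) : set X * set X :=
  if k is i.+1 then
    let: (U, V) := greedy_matching T C nu i in
    let E := (C `\` U) `&` T (nu i) @^-1` (C `\` V) in
    (U `|` E, V `|` T (nu i) @` E)
  else (set0, set0).

Lemma greedy_matchingS (X : Type) (T : int * int -> X -> X) C nu k :
  let S := greedy_matching T C nu k in
  let E := (C `\` S.1) `&` T (nu k) @^-1` (C `\` S.2) in
  greedy_matching T C nu k.+1 = (S.1 `|` E, S.2 `|` T (nu k) @` E).
Proof. by move=> /=; case: greedy_matching. Qed.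

Section greedy.
Context (R : realType) (d : measure_display) (X : measurableType d)
  (mu : {measure set X -> \bar R}) (T : int * int -> X -> X)
  (act : measure_preserving_action mu T)
  (C : set X) (mC : measurable C) (nu : nat -> int * int).
Let S k := (greedy_matching T C nu k).1.
Let S' k := (greedy_matching T C nu k).2.
Let E k := (C `\` S k) `&` T (nu k) @^-1` (C `\` S' k).

Let SS k : S k.+1 = S k `|` E k.
Proof. by rewrite /S greedy_matchingS. Qed.

Let S'S k : S' k.+1 = S' k `|` T (nu k) @` E k.
Proof. by rewrite /S' greedy_matchingS. Qed.

Let matching_sub k : S k `<=` C /\ S' k `<=` C.
Proof.
elim: k => [|k [SC S'C]]; first by split.
rewrite SS S'S; split; rewrite subUset; split => //.
  by move=> x [[]].
by move=> _ [x [_ []] ? _ <-].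
Qed.

Let mE_of k : measurable (S k) -> measurable (S' k) -> measurable (E k).
Proof.
move=> mS mS'; apply: measurableI; first exact: measurableD.
by apply: (measurable_action_preimage act); exact: measurableD.
Qed.

Let matching_meas k : measurable (S k) /\ measurable (S' k).
Proof.
elim: k => [|k [mS mS']]; first by split; exact: measurable0.
have mEk := mE_of mS mS'.
rewrite SS S'S; split; apply: measurableU => //.
exact: (measurable_action_image act).
Qed.

Let mE k : measurable (E k).
Proof. by have [mS mS'] := matching_meas k; exact: mE_of. Qed.

Let mTE k : measurable (T (nu k) @` E k).
Proof. exact: (measurable_action_image act). Qed.

Let dSE k A : (S k `\` A) `&` (E k `\` A) = set0.
Proof. by rewrite -subset0 => x [[Sx _] [[[_ nSx] _] _]]. Qed.

Let dS'E k A : (S' k `\` A) `&` (T (nu k) @` E k `\` A) = set0.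
Proof.
rewrite -subset0 => y [[S'y _] [[x [_ [_ nS']] Txy] _]].
by apply: nS'; rewrite Txy.
Qed.

(* [measureU] and [measureU2] produce [mu] as a content, which then fails to
   rewrite with [action_preserving]. *)
Let muU A B : measurable A -> measurable B -> A `&` B = set0 ->
  mu (A `|` B) = (mu A + mu B)%E.
Proof. exact: measureU. Qed.

Let muU2 A B : measurable A -> measurable B ->
  (mu (A `|` B) <= mu A + mu B)%E.
Proof. exact: measureU2. Qed.

Let matching_eq k : mu (S k) = mu (S' k).
Proof.
elim: k => // k IH; have [mS mS'] := matching_meas k.
have := dSE k set0; have := dS'E k set0; rewrite !setD0 => dS' dS.
by rewrite SS S'S !muU// IH (measure_action_image act).
Qed.

(** If both ends of a pair matched at step [i] lay in [B], the target would lie in [B] and in its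
    image under [T (nu i)], a null intersection. So almost every source lies outside [B] or has its
    target outside [B], and each [T (nu i)] preserves measure. *)
Let matching_bound k B : measurable B ->
  (forall i, (i < k)%N -> mu (B `&` T (nu i) @` B) = 0%E) ->
  (mu (S k) <= mu (S k `\` B) + mu (S' k `\` B))%E.
Proof.
move=> mB; elim: k => [|k IH] B0; first by rewrite measure0 adde_ge0.
have [mS mS'] := matching_meas k.
have mTB : measurable (T (nu k) @` B) := measurable_action_image act _ mB.
rewrite SS S'S !setDUl muU//; last first.
  by have := dSE k set0; rewrite !setD0.
rewrite !muU//; try exact: measurableD.
rewrite addeACA leeD ?IH// => [i ik|]; first by rewrite B0// ltnS ltnW.
have mTED : measurable (T (nu k) @` E k `\` B) by exact: measurableD.
have sub : E k `<=` (E k `\` B) `|` (T (nu k) @^-1` (T (nu k) @` E k `\` B)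
    `|` T (nu k) @^-1` (B `&` T (nu k) @` B)).
  move=> x Ex; have [Bx|nBx] := pselect (B x); last by left.
  right; have [BTx|nBTx] := pselect (B (T (nu k) x)).
    by right; split=> //; exists x.
  by left; split => //; exists x.
have mp := measurable_action_preimage act.
have mI : measurable (B `&` T (nu k) @` B) by exact: measurableI.
have mU := measurableU _ _ (mp (nu k) _ mTED) (mp (nu k) _ mI).
have mEB : measurable (E k `\` B) by exact: measurableD.
apply: (le_trans (le_measure mu _ _ sub)); rewrite ?inE//.
  exact: measurableU.
apply: (le_trans (muU2 _ _)) => //; rewrite leeD2l//.
apply: (le_trans (muU2 _ _)) => //; try exact: mp.
by rewrite !(action_preserving act)// B0// adde0.
Qed.

(** By contradiction: for each [k], a set [B] without returns bounds [mu (S k)] by twice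
    [mu (C \ B)], hence by a third of [mu C]. The bound passes to the limit for sources and for
    targets, and the unmatched rest is null, so [mu C] would be at most two thirds of itself. *)
Lemma returns_along_finite :
  (mu C < +oo)%E -> (0 < mu C)%E ->
  (forall W, measurable W -> W `<=` C ->
    (forall i, W `&` T (nu i) @` W = set0) -> mu W = 0%E) ->
  exists k, returns_along mu T C [seq nu i | i <- iota 0 k].
Proof.
move=> Cfin C0 null; apply: contrapT => /forallNP noret.
have Sle k : (mu (S k) <= (fine (mu C) / 3)%:E)%E.
  have /existsNP[B /not_implyP[mB /not_implyP[BC]]] := noret k.
  move=> /not_implyP[BC6 nB].
  have [mS mS'] := matching_meas k; have [SC S'C] := matching_sub k.
  have mCB : measurable (C `\` B) by exact: measurableD.
  have CBfin : mu (C `\` B) \is a fin_num.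
    rewrite ge0_fin_numE//; apply: le_lt_trans Cfin.
    by apply: le_measure; rewrite ?inE//; exact: subDsetl.
  have CF : mu C \is a fin_num by rewrite ge0_fin_numE.
  apply: le_trans (_ : mu (C `\` B) + mu (C `\` B) <= _)%E; last first.
    move: BC6; rewrite -(fineK CBfin) -(fineK CF) -EFinM -EFinD lte_fin lee_fin/=.
    by lra.
  apply: (le_trans (matching_bound mB _)) => [i ik|].
    apply/eqP; rewrite -measure_le0 leNgt; apply/negP => Bpos.
    by apply: nB; exists (nu i) => //; apply: map_f; rewrite mem_iota.
  by apply: leeD; apply: le_measure; rewrite ?inE//; try exact: measurableD;
    exact: setSD.
have mS k : measurable (S k) by have [] := matching_meas k.
have mS' k : measurable (S' k) by have [] := matching_meas k.
have mUS : measurable (\bigcup_k S k) by exact: bigcupT_measurable.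
have mUS' : measurable (\bigcup_k S' k) by exact: bigcupT_measurable.
have limle F : (forall k, measurable (F k)) -> (forall k, F k `<=` F k.+1) ->
    (forall k, mu (F k) <= (fine (mu C) / 3)%:E)%E ->
    (mu (\bigcup_k F k) <= (fine (mu C) / 3)%:E)%E.
  move=> mF Fi Fle.
  have cF : mu \o F @ \oo --> mu (\bigcup_k F k).
    apply: nondecreasing_cvg_mu => //; first exact: bigcupT_measurable.
    by apply/nondecreasing_seqP => n; exact/subsetPset/Fi.
  rewrite -(cvg_lim _ cF)//; apply: lime_le.
    by apply/cvg_ex; eexists; exact: cF.
  by apply: nearW => k /=; exact: Fle.
have USle : (mu (\bigcup_k S k) <= (fine (mu C) / 3)%:E)%E.
  by apply: limle => // k; rewrite SS; left.
have US'le : (mu (\bigcup_k S' k) <= (fine (mu C) / 3)%:E)%E.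
  by apply: limle => // k; rewrite ?S'S -?matching_eq//; left.
(* [W] holds the points that are never matched: a return of [W] to itself along [nu i] would have
   been matched at step [i]. *)
pose W := C `\` (\bigcup_k S k `|` \bigcup_k S' k).
have mW : measurable W by apply: measurableD => //; exact: measurableU.
have W0 : mu W = 0%E.
  apply: null => // [|i]; first exact: subDsetl.
  rewrite -subset0 => y [+ [x [Cx nx] Txy]]; rewrite -Txy => -[CTx nTx].
  have Ex : E i x.
    by split; split => // ?; [apply: nx; left | apply: nTx; right]; exists i.
  by apply: nx; left; exists i.+1 => //; rewrite SS; right.
have CF : mu C \is a fin_num by rewrite ge0_fin_numE.
have : (mu C <= mu W + (mu (\bigcup_k S k) + mu (\bigcup_k S' k)))%E.
  have mU := measurableU _ _ mUS mUS'.
  apply: le_trans (_ : mu (W `|` (\bigcup_k S k `|` \bigcup_k S' k)) <= _)%E.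
    apply: le_measure; rewrite ?inE//; first exact: measurableU.
    move=> x Cx; rewrite /W.
    by have [] := pselect ((\bigcup_k S k `|` \bigcup_k S' k) x);
      [right|left].
  apply: (le_trans (muU2 _ _)) => //; rewrite leeD2l//.
  exact: muU2.
rewrite W0 add0e => /le_trans/(_ (leeD USle US'le)).
by move: C0; rewrite -(fineK CF) -EFinD lte_fin lee_fin/=; lra.
Qed.

End greedy.

(** * Completion of a measure *)

Section completion.
Context (R : realType) (d : measure_display) (X : measurableType d)
  (mu : {measure set X -> \bar R}).

Lemma completed_algebra_genD (E N : set X) :
  measurable E -> mu.-negligible N -> completed_algebra_gen mu (E `\` N).
Proof.
move=> mE [N' [mN' N'0 NN']]; exists (E `\` N'); first exact: measurableD.
exists ((E `&` N') `\` N); first by exists N'; split=> // x [[]].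
apply/seteqP; split=> x.
  by move=> [[Ex nx]|[[Ex _] nx]]; split=> // /NN'.
move=> [Ex nx]; have [N'x|nN'x] := pselect (N' x); [right|left] => //.
Qed.

Lemma measurable_completed (E : set X) :
  measurable E -> completed_algebra_gen mu E.
Proof.
by move=> mE; rewrite -(setD0 E); apply: completed_algebra_genD => //;
  exact: negligible_set0.
Qed.

(** The completion only adds subsets of null sets, so dropping the added part costs no measure. *)
Lemma completed_inner_measurable (E : set X) : completed_algebra_gen mu E ->
  exists E', [/\ measurable E', E' `<=` E & mu E' = mu_ext mu E].
Proof.
move=> [E' mE' [N [N' [mN' N'0 NN']] <-]]; exists E'; split=> //.
have E'E : E' `<=` E' `|` N by left.
apply/eqP; rewrite eq_le -{1}(measurable_mu_extE mu mE') le_mu_ext//=.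
have mU : measurable (E' `|` N') by exact: measurableU.
have E'N' : E' `|` N `<=` E' `|` N' by exact: setUS.
apply: le_trans (le_mu_ext mu E'N') _.
by rewrite measurable_mu_extE// measureU0.
Qed.

Lemma negligible_mu_ext (N : set X) : mu.-negligible N -> mu_ext mu N = 0%E.
Proof.
move=> [N' [mN' N'0 NN']]; apply/eqP; rewrite eq_le mu_ext_ge0// andbT.
by rewrite -N'0 -(measurable_mu_extE mu mN') le_mu_ext.
Qed.

Lemma le_mu_extD_negligible (E N : set X) : measurable E ->
  mu.-negligible N -> (mu E <= mu_ext mu (E `\` N))%E.
Proof.
move=> mE [N' [mN' N'0 NN']].
have mD : measurable (E `\` N') by exact: measurableD.
apply: le_trans (_ : mu (E `\` N') <= _)%E; last first.
  rewrite -(measurable_mu_extE mu mD); apply: le_mu_ext.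
  by move=> x [Ex nx]; split=> // /NN'.
rewrite -(measureU0 mD mN' N'0); apply: le_measure; rewrite ?inE//.
  exact: measurableU.
by move=> x Ex; have [N'x|nN'x] := pselect (N' x); [right|left].
Qed.

End completion.

(** * A countable family approximating all sets of positive measure *)

Lemma sigma_finite_positive_finite (R : realType) (d : measure_display)
    (X : measurableType d) (mu : {measure set X -> \bar R}) (A : set X) :
  sigma_finite [set: X] mu -> measurable A -> (0 < mu A)%E ->
  exists B, [/\ measurable B, B `<=` A, (0 < mu B)%E & (mu B < +oo)%E].
Proof.
move=> [F FT /all_and2[mF Ffin]] mA A0; apply: contrapT => /forallNP nB.
suff : mu.-negligible A.
  by move/(negligibleP mu mA) => A00; rewrite A00 ltxx in A0.
rewrite -(setIT A) FT setI_bigcupr; apply: negligible_bigcup => k.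
have mI : measurable (A `&` F k) by exact: measurableI.
apply/(negligibleP mu mI)/eqP; rewrite -measure_le0 leNgt; apply/negP => I0.
apply: (nB (A `&` F k)); split => //.
by apply: le_lt_trans (Ffin k); apply: le_measure; rewrite ?inE//.
Qed.

(** Finite lists of rational pairs form a countable type, so they can index a countable family. *)
Definition rational_intervals (R : realType) (s : seq (rat * rat)) : set R :=
  \bigcup_(pq in [set` s]) [set` `]ratr pq.1, ratr pq.2[ ].
Arguments rational_intervals : clear implicits.

Lemma measurable_rational_intervals (R : realType) (s : seq (rat * rat)) :
  measurable (rational_intervals R s).
Proof.
by rewrite /rational_intervals bigcup_seq; apply: bigsetU_measurable => pq _;
  exact: measurable_itv.
Qed.

Lemma open_rational_interval (R : realType) (U : set R) (x : R) :
  open U -> U x ->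
  exists pq : rat * rat, (ratr pq.1 < x < ratr pq.2) /\
    [set` `]ratr pq.1, (ratr pq.2 : R)[ ] `<=` U.
Proof.
move=> oU Ux; have /nbhs_ballP[e /= e0 eU] : nbhs x U by exact: open_nbhs_nbhs.
have /rat_in_itvoo[p] : x - e < x by rewrite ltrBlDr ltrDl.
have /rat_in_itvoo[q] : x < x + e by rewrite ltrDl.
rewrite !in_itv/= => /andP[xq qe] /andP[ep px]; exists (p, q); split=> /=.
  by rewrite px.
move=> y /=; rewrite in_itv/= => /andP[py yq]; apply: eU.
by rewrite /ball/= ltr_norml; apply/andP; split; lra.
Qed.

(** Outer regularity encloses [G] in an open [U] with excess below a twelfth of the measure of [G].
    Rational intervals inside [U] exhaust [G], so some finite union of them covers more than half of
    [G], while six times its excess stays below that half. *)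
Lemma rational_intervals_density (R : realType) (G : set R) :
  measurable G -> (0 < lebesgue_measure G < +oo)%E ->
  exists s, (6%:E * lebesgue_measure (rational_intervals R s `\` G) <
             lebesgue_measure (rational_intervals R s `&` G))%E.
Proof.
move=> mG /andP[G0 Gfin].
have GF : lebesgue_measure G \is a fin_num by rewrite ge0_fin_numE.
have eps0 : 0 < fine (lebesgue_measure G) / 12.
  by rewrite divr_gt0// -lte_fin fineK.
have [U [oU GU UG]] := lebesgue_regularity_outer mG Gfin eps0.
pose inU (pq : rat * rat) := `[< [set` `]ratr pq.1, (ratr pq.2 : R)[ ] `<=` U >].
(* Lists growing with [k]: the pairs with code below [k] whose interval lies in [U]. *)
pose s k := [seq pq <- pmap unpickle (iota 0 k) | inU pq].
pose J k := rational_intervals R (s k).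
have mJ k : measurable (J k) by exact: measurable_rational_intervals.
have JU k : J k `<=` U.
  by move=> x [pq /=]; rewrite mem_filter => /andP[/asboolP pqU _] /pqU.
have JG : \bigcup_k (J k `&` G) = G.
  apply/seteqP; split=> [x [k _ []]//|x Gx].
  have [pq [xpq pqU]] := open_rational_interval oU (GU _ Gx).
  exists (pickle pq).+1 => //; split=> //; exists pq => //=.
  rewrite mem_filter; apply/andP; split; first exact/asboolP.
  rewrite mem_pmap; apply/mapP; exists (pickle pq); last by rewrite pickleK.
  by rewrite mem_iota/= add0n.
apply: contrapT => /forallNP ns.
have Jle k : (lebesgue_measure (J k `&` G) <=
              (fine (lebesgue_measure G) / 2)%:E)%E.
  have /negP := ns (s k); rewrite -leNgt => /le_trans; apply.
  have JUG : (lebesgue_measure (J k `\` G) <=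
              (fine (lebesgue_measure G) / 12)%:E)%E.
    apply: le_trans (ltW UG); apply: le_measure.
    - by rewrite inE; exact: (measurableD (mJ k) mG).
    - by rewrite inE; exact: (measurableD (open_measurable oU) mG).
    - exact: setSD.
  apply: le_trans (_ : 6%:E * (fine (lebesgue_measure G) / 12)%:E <= _)%E.
    by rewrite lee_wpmul2l// lee_fin.
  by rewrite -EFinM lee_fin; lra.
have cJ : lebesgue_measure \o (fun k => J k `&` G) @ \oo --> lebesgue_measure G.
  rewrite -[in X in _ --> X]JG; apply: nondecreasing_cvg_mu.
  - by move=> k; exact: (measurableI _ _ (mJ k) mG).
  - by rewrite JG.
  - apply/nondecreasing_seqP => k; apply/subsetPset; apply: setSI.
    move=> x [pq /= pqs xpq]; exists pq => //=; move: pqs.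
    rewrite /s -[k.+1]addn1 iotaD/= pmap_cat filter_cat mem_cat => ->//.
have : (lebesgue_measure G <= (fine (lebesgue_measure G) / 2)%:E)%E.
  rewrite -{1}(cvg_lim _ cJ)//; apply: lime_le.
    by apply/cvg_ex; eexists; exact: cJ.
  by apply: nearW => k /=; exact: Jle.
by move: eps0; rewrite -{2}(fineK GF) lee_fin; lra.
Qed.

(** A set that contains an atom is approximated by that atom alone. Any other set of positive
    measure has a part of finite measure that [f] carries, mod 0, to the line, where finite unions
    of rational intervals approximate it. *)
Lemma lebesgue_space_countable_dense (R : realType) (d : measure_display)
    (X : measurableType d) (mu : {measure set X -> \bar R}) :
  lebesgue_space mu -> sigma_finite [set: X] mu ->
  exists (I : countType) (C : I -> set X),
    (forall i, measurable (C i)) /\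
    forall A, measurable A -> (0 < mu A)%E ->
    exists i, (mu (C i) < +oo)%E /\ (6%:E * mu (C i `\` A) < mu (C i))%E.
Proof.
move=> [D [N [I [M [f [/countable_injP[g ginj] Dpos negN negM [fbij fiso]]]]]]] sf.
pose Y := ~` (D `|` N); pose Z := [set` I] `\` M.
pose lam := @lebesgue_measure R.
have lamE (E : set R) : measurable E -> mu_ext lam E = lam E.
  by move=> mE; exact: measurable_mu_extE.
have finj : {in Y &, injective f} by have [] := fbij.
have fY x : Y x -> Z (f x) by have [+ _ _] := fbij; exact.
have Zf : Z `<=` f @` Y by have [] := fbij.
(* Atoms are only given in the completed algebra. Such a singleton is a measurable set plus a
   negligible one, and its positive measure forces the measurable part to be all of it. *)
have mD x : D x -> measurable [set x].
  move=> /Dpos[[A mA [K negK AK]] x0].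
  suff -> : [set x] = A by [].
  have Ax : A `<=` [set x] by rewrite -AK; left.
  apply/seteqP; split=> // _ ->; apply: contrapT => nAx.
  suff negx : mu.-negligible [set x] by rewrite negligible_mu_ext ?ltxx in x0.
  apply: negligibleS negK; rewrite -AK => y [Ay|//].
  by case: nAx; rewrite -(Ax _ Ay).
pose J s := rational_intervals R s.
have mJ s : measurable (J s) := measurable_rational_intervals s.
have fJ s : f @` (Y `&` f @^-1` J s) = J s `&` Z.
  apply/seteqP; split=> [_ [x [Yx Jx] <-]|y [Jy /[dup] Zy /Zf[x Yx fxy]]].
    by split => //; exact: fY.
  by exists x => //; split=> //=; rewrite fxy.
(* The pullback of [J s] is only known to lie in the completed algebra; [E' s] is a measurable
   subset of full measure in it. *)
have /choice[E' E'P] s : exists E', [/\ measurable E', E' `<=` Y `&` f @^-1` J s &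
    mu E' = mu_ext lam (J s `&` Z)].
  have sub : Y `&` f @^-1` J s `<=` Y by [].
  have [cE eE] := fiso _ sub; rewrite fJ in cE eE.
  have cJ : completed_algebra_gen lam (J s `&` Z).
    rewrite /Z setIDA; apply: completed_algebra_genD => //.
    exact: (measurableI _ _ (mJ s) (measurable_itv I)).
  by rewrite -(eE (cE.2 cJ)); exact: completed_inner_measurable (cE.2 cJ).
exists (nat + seq (rat * rat))%type.
exists (fun i => match i with
  | inl j => D `&` g @^-1` [set j] | inr s => E' s end).
have Dg x : D x -> D `&` g @^-1` [set g x] = [set x].
  move=> Dx; apply/seteqP; split=> [y [Dy gyx]|_ ->//].
  by apply: ginj => //; rewrite inE.
split=> [[j|s]|A0 mA0 A0pos].
- have [[x [Dx <-]]|nx] := pselect (exists x, D x /\ g x = j).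
    by rewrite Dg//; exact: mD.
  rewrite (_ : D `&` _ = set0)//; rewrite -subset0 => x [Dx gx].
  by apply: nx; exists x.
- by have [] := E'P s.
(* [A0] is shrunk to a part of finite measure, as [rational_intervals_density] requires. *)
have [A [mA AA0 Apos Afin]] := sigma_finite_positive_finite sf mA0 A0pos.
have [[x [Dx Ax]]|nDA] := pselect (exists x, D x /\ A x).
  exists (inl (g x)) => /=; rewrite Dg//; have mx := mD _ Dx; split.
    by apply: le_lt_trans Afin; apply: le_measure; rewrite ?inE// => _ ->.
  rewrite (_ : _ `\` _ = set0); last first.
    by rewrite -subset0 => _ [-> nA]; apply: nA; exact: AA0.
  by rewrite measure0 mule0 -(measurable_mu_extE mu mx); have [] := Dpos _ Dx.
have AN : A `\` N `<=` Y.
  by move=> x [Ax nNx] [Dx|//]; apply: nDA; exists x.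
have [cAN /(_ (completed_algebra_genD mA negN)) eAN] := fiso _ AN.
have /completed_inner_measurable[G [mG GA Gmeas]] :=
  cAN.1 (completed_algebra_genD mA negN).
have lamG : (0 < lam G < +oo)%E.
  have -> : lam G = mu_ext mu (A `\` N) by rewrite eAN.
  rewrite (lt_le_trans Apos (le_mu_extD_negligible mA negN))/=.
  apply: le_lt_trans Afin; rewrite -(measurable_mu_extE mu mA).
  by apply: le_mu_ext.
have [s sG] := rational_intervals_density mG lamG.
have [mE' E'sub E'meas] := E'P s.
exists (inr s) => /=.
have mJG : measurable (J s `&` G) := measurableI _ _ (mJ s) mG.
have mJDG : measurable (J s `\` G) := measurableD (mJ s) mG.
have JGZ : J s `&` G `<=` J s `&` Z.
  by apply: setIS => y /GA[x ANx <-]; exact/fY/AN.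
have JG_le : (lam (J s `&` G) <= mu (E' s))%E.
  by rewrite E'meas -(lamE _ mJG); exact: le_mu_ext.
have JGfin : (lam (J s `&` G) < +oo)%E.
  by have /andP[_] := lamG; apply: le_lt_trans; apply: le_measure; rewrite ?inE.
split.
  (* Finiteness of [lam (J s)]: by [sG], its part outside [G] is smaller than its part inside, which
     is finite. *)
  rewrite E'meas; apply: le_lt_trans (_ : lam (J s) < +oo)%E.
    by rewrite -(lamE _ (mJ s)); exact: le_mu_ext.
  have -> : J s = (J s `\` G) `|` (J s `&` G) by rewrite setUC setUIDK.
  have : (lam ((J s `\` G) `|` (J s `&` G)) <=
          lam (J s `\` G) + lam (J s `&` G))%E.
    exact: (measureU2 (@lebesgue_measure R) mJDG mJG).
  move/le_lt_trans; apply.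
  apply: lte_add_pinfty => //; apply: le_lt_trans (lt_trans sG JGfin).
  by rewrite -{1}(mul1e (lam _)) lee_wpmul2r// lee_fin; lra.
apply: lt_le_trans JG_le; apply: le_lt_trans sG; rewrite lee_wpmul2l//.
have mE'A : measurable (E' s `\` A0) by exact: measurableD.
have E'AY : E' s `\` A0 `<=` Y by move=> x [/E'sub[]].
rewrite -(measurable_mu_extE mu mE'A).
(* As [G] consists of images of points of [A] and [f] is injective on [Y], points of [E' s] outside
   [A0] are sent into [J s] outside [G]. *)
apply: le_trans (_ : mu_ext lam (J s `\` G) <= _)%E; last by rewrite lamE.
have [_ ->] := fiso _ E'AY; last exact: measurable_completed.
apply: le_mu_ext => _ [x [/E'sub[Yx Jx] nAx] <-]; split=> // /GA[y [Ay nNy]].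
have Yy : Y y by exact: AN.
move=> /finj; rewrite !inE => /(_ Yy Yx) yx.
by apply: nAx; rewrite -yx; exact: AA0.
Qed.

(** * Openness in the direction *)

Lemma open_tunnel (R : realType) (e : R) (p : R * R) :
  open [set theta | tunnel e theta p].
Proof.
(* For fixed [t], the distance from [p] to the point with parameter [t] on the line is continuous in
   [theta]. *)
pose D t (theta : R) :=
  Num.sqrt ((p.1 - t * cos theta) ^+ 2 + (p.2 - t * sin theta) ^+ 2).
rewrite (_ : [set _ | _] = \bigcup_(t in [set: R]) (D t @^-1` [set x | x < e])).
  apply: bigcup_open => t _; apply: open_comp; last exact: open_lt.
  move=> theta _; apply: continuous_comp; last exact: sqrt_continuous.
  by apply: cvgD; apply: cvgM; (apply: cvgB; first exact: cvg_cst);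
    (apply: cvgM; first exact: cvg_cst);
    (exact: continuous_cos || exact: continuous_sin).
by apply/seteqP; split=> theta [t _ Dt]; exists t.
Qed.

Lemma tunnel_le (R : realType) (e e' theta : R) :
  e <= e' -> tunnel e theta `<=` tunnel e' theta.
Proof. by move=> ee' p [t _ pt]; exists t => //; exact: lt_le_trans pt ee'. Qed.

Definition tunnel_returns (R : realType) (d : measure_display)
    (X : measurableType d) (mu : set X -> \bar R) (T : int * int -> X -> X)
    (e : R) (C : set X) : set R :=
  [set theta | exists2 F : seq (int * int),
    forall n, n \in F -> n != 0 /\ tunnel e theta (n.1%:~R, n.2%:~R) &
    returns_along mu T C F].

(** [returns_along] does not involve [theta], so this is a union over lists [F] of finite
    intersections of sets open by [open_tunnel]. *)
Lemma open_tunnel_returns (R : realType) (d : measure_display)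
    (X : measurableType d) (mu : set X -> \bar R) (T : int * int -> X -> X)
    (e : R) (C : set X) :
  open (tunnel_returns mu T e C).
Proof.
pose V (F : seq (int * int)) : set R :=
  [set theta | forall n : int * int, n \in F ->
     n != 0 /\ tunnel e theta (n.1%:~R, n.2%:~R)].
rewrite (_ : tunnel_returns _ _ _ _ =
    \bigcup_(F in [set F | returns_along mu T C F]) V F); last first.
  by apply/seteqP; split=> theta [F]; exists F.
apply: bigcup_open => F _; elim: F => [|n F IH].
  by rewrite (_ : V _ = setT); [exact: openT|apply/seteqP; split].
have [->|n0] := eqVneq n 0.
  rewrite (_ : V _ = set0); first exact: open0.
  by rewrite -subset0 => theta /(_ _ (mem_head _ _))[/eqP].
rewrite (_ : V _ = [set theta | tunnel e theta (n.1%:~R, n.2%:~R)] `&` V F).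
  by apply: openI => //; exact: open_tunnel.
apply/seteqP; split=> [theta Vn|theta [nt Vt] m].
  split; first by have [] := Vn _ (mem_head _ _).
  by move=> m mF; apply: Vn; rewrite inE mF orbT.
by rewrite inE => /orP[/eqP->|/Vt].
Qed.

(** * Recurrence in terms of finite lists of returns *)

Lemma recurrent_tunnel_returns (R : realType) (d : measure_display)
    (X : measurableType d) (mu : {measure set X -> \bar R})
    (T : int * int -> X -> X) (act : measure_preserving_action mu T)
    (theta e : R) (C : set X) :
  recurrent_direction mu T theta -> 0 < e -> measurable C -> (mu C < +oo)%E ->
  tunnel_returns mu T e C theta.
Proof.
move=> rec e0 mC Cfin; have [C0|] := boolP (0 < mu C)%E; last first.
  (* For a null [C], no [B] satisfies the strict inequality, so the empty list serves. *)
  rewrite -leNgt measure_le0 => /eqP C0; exists [::] => // B _ _.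
  by rewrite C0 ltNge mule_ge0.
have [n0 [n00 tn0 _]] := rec _ _ e0 mC C0.
(* [nu] enumerates the nonzero vectors of the tunnel; the default [n0], itself one of them, fills
   all other codes. *)
pose N n := n != 0 /\ tunnel e theta (n.1%:~R, n.2%:~R).
pose nu j : int * int :=
  if unpickle j is Some n then if `[< N n >] then n else n0 else n0.
have Nnu j : N (nu j).
  by rewrite /nu; case: unpickle => [n|//]; case: asboolP.
have [k retk] : exists k, returns_along mu T C [seq nu i | i <- iota 0 k].
  apply: (returns_along_finite act) => // W mW _ WT; apply/eqP.
  rewrite -measure_le0 leNgt; apply/negP => W0.
  have [n [nn0 tn]] := rec _ _ e0 mW W0.
  suff -> : n = nu (pickle n) by rewrite WT measure0 ltxx.
  by rewrite /nu pickleK; case: asboolP => // -[].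
by exists [seq nu i | i <- iota 0 k] => // _ /mapP[j _ ->]; exact: Nnu.
Qed.

Lemma tunnel_returns_recurrent (R : realType) (d : measure_display)
    (X : measurableType d) (mu : {measure set X -> \bar R})
    (T : int * int -> X -> X) (act : measure_preserving_action mu T)
    (theta e : R) (C A : set X) :
  tunnel_returns mu T e C theta -> measurable C -> measurable A ->
  (6%:E * mu (C `\` A) < mu C)%E ->
  exists n : int * int, [/\ n != 0, tunnel e theta (n.1%:~R, n.2%:~R) &
    (0 < mu (A `&` T n @` A))%E].
Proof.
move=> [F FN Fret] mC mA CA.
have mCA : measurable (C `&` A) by exact: measurableI.
have [|n nF CA0] := Fret _ mCA (@subIsetl _ _ _).
  by rewrite setDIr setDv set0U.
have [n0 tn] := FN _ nF; exists n; split=> //.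
apply: lt_le_trans CA0 _; apply: le_measure; rewrite ?inE.
- by apply: measurableI => //; exact: (measurable_action_image act).
- by apply: measurableI => //; exact: (measurable_action_image act).
- by apply: setISS; [exact: subIsetr|apply: image_subset; exact: subIsetr].
Qed.

(** * Countable intersections and recurrent directions *)

Lemma Gdelta_bigcap_countType (S : topologicalType) (I : countType)
    (V : I -> set S) :
  (forall i, open (V i)) -> Gdelta (\bigcap_i V i).
Proof.
move=> oV; exists (fun j => if unpickle j is Some i then V i else setT).
  by move=> j; case: unpickle => [i|]; [exact: oV|exact: openT].
apply/seteqP; split=> x Vx i _; first by case: unpickle => // j; exact: Vx.
by have := Vx (pickle i) Logic.I; rewrite pickleK.
Qed.

Unset Implicit Arguments.

Theorem theorem1p3 (R : realType) (d : measure_display) (X : measurableType d)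
    (mu : {measure set X -> \bar R}) (T : int * int -> X -> X)
    (mu_lebesgue : lebesgue_space mu)
    (mu_sigma_finite : sigma_finite [set: X] mu)
    (mu_infinite : mu [set: X] = +oo%E)
    (T_action : measure_preserving_action mu T)
    (T_recurrent : recurrent_action mu T)
    (T_ergodic : ergodic_action mu T) :
  Gdelta (recurrent_directions mu T : set (subspace `[0, pi[%classic)).
Proof.
have [I [C [mC dense]]] :=
  lebesgue_space_countable_dense mu_lebesgue mu_sigma_finite.
(* Sets [C i] of infinite measure, to which [recurrent_tunnel_returns] does not apply, impose no
   condition; [dense] always supplies one of finite measure. *)
pose V (ki : nat * I) : set R :=
  if (mu (C ki.2) < +oo)%E then tunnel_returns mu T ki.1.+1%:R^-1 (C ki.2)
  else setT.
have oV ki : open (V ki).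
  by rewrite /V; case: ifP => _; [exact: open_tunnel_returns|exact: openT].
(* Each factor is cut down to [[0, pi)], where it is open in the subspace topology, so that the
   intersection itself confines [theta]. *)
rewrite (_ : recurrent_directions mu T = \bigcap_ki (V ki `&` `[0, pi[)).
  apply: Gdelta_bigcap_countType => ki; apply/open_subspaceP; exists (V ki) => //.
  by rewrite -setIA setIid.
apply/seteqP; split=> [theta [theta_pi rec] [k i] _|theta Vtheta].
  split; last by rewrite /= in_itv.
  rewrite /V/=; case: ifP => // Cfin.
  by apply: recurrent_tunnel_returns => //; exact: T_action.
have theta_pi : 0 <= theta < pi.
  (* An index is needed to read off the confinement; approximating the whole space, of positive
     measure, provides one. *)
  have [|i _] := dense setT measurableT; first by rewrite mu_infinite.
  by have [_] := Vtheta (0%N, i) Logic.I; rewrite /= in_itv.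
split=> // e A e0 mA A0; have [i [Cfin CA]] := dense _ mA A0.
(* Widths [1/(k+1)] suffice, since a narrower tunnel lies in a wider one. *)
have [k _ /(_ k (leqnn k)) ke] := near_infty_natSinv_lt (PosNum e0).
have [] := Vtheta (k, i) Logic.I; rewrite /V/= Cfin => ret _.
have [n [n0 tn An]] := tunnel_returns_recurrent T_action ret (mC i) mA CA.
by exists n; split=> //; apply: tunnel_le tn; exact: ltW.
Qed.
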